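(* Let $\Sigma\subset\mathbb R^2$ be a damping set, $S:\mathbb R\rightrightarrows\mathbb R$ the set-valued map whose graph is $R\Sigma$, and $p\in[1,+\infty]$. If the wave equation associated with $\Sigma$ is strongly stable in $\mathsf X_p$, then $S^{[2]}$ is a strict damping. Conversely, assume that $S^{[2]}$ is a strict damping and that the function $\rho:\mathbb R_+\to\mathbb R_+$ defined by $$\rho(r)=\lim_{\eta\to0^+}\ \sup_{|x|\le r+\eta}\|S^{[2]}(x)\|$$ satisfies $\rho(r)<r$ for every $r>0$. Then the wave equation associated with $\Sigma$ is strongly stable in $\mathsf X_p$.
   Context: Notation: $\mathbb R_+=[0,+\infty)$, $R=\begin{pmatrix}\frac1{\sqrt2}&\frac1{\sqrt2}\\-\frac1{\sqrt2}&\frac1{\sqrt2}\end{pmatrix}$ and $R\Sigma=\{R\xi:\xi\in\Sigma\}$. The graph of $S:\mathbb R\rightrightarrows\mathbb R$ is $\{(x,y):y\in S(x)\}$. $S^{[2]}=S\circ S$, i.e. $z\in S^{[2]}(x)$ iff there is $y\in S(x)$ with $z\in S(y)$. For $A\subset\mathbb R$, $\|A\|=\sup_{a\in A}|a|$. $L^p_{\mathrm{loc}}(a,+\infty)$ is the set of measurable functions whose restriction to $(a,T)$ is in $L^p$ for every $T>a$. $W^{1,p}_*(0,1)=\{u\in L^p(0,1): u'\in L^p(0,1),\ u(0)=0\}$ and $\mathsf X_p=W^{1,p}_*(0,1)\times L^p(0,1)$, with norm $\|(u,v)\|_{\mathsf X_p}^p=2^{-p/2}\int_0^1(|u'+v|^p+|u'-v|^p)\,dx$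 if $p<+\infty$ and $\|(u,v)\|_{\mathsf X_\infty}=\frac1{\sqrt2}\max(\|u'+v\|_{L^\infty(0,1)},\|u'-v\|_{L^\infty(0,1)})$. The wave equation associated with $\Sigma$ is: $z_{tt}=z_{xx}$ on $\mathbb R_+\times[0,1]$; $z(t,0)=0$ and $(z_t(t,1),-z_x(t,1))\in\Sigma$ for $t\in\mathbb R_+$; $z(0,x)=z_0(x)$, $z_t(0,x)=z_1(x)$ for $x\in[0,1]$. A (weak, global in time) solution in $\mathsf X_p$ with initial condition $(z_0,z_1)\in\mathsf X_p$ is a function $z:\mathbb R_+\times[0,1]\to\mathbb R$ for which there exist $f\in L^p_{\mathrm{loc}}(0,+\infty)$ and $g\in L^p_{\mathrm{loc}}(-1,+\infty)$ such that $z(t,x)=\frac1{\sqrt2}\int_0^{t+x}f+\frac1{\sqrt2}\int_0^{t-x}g$ for all $(t,x)\in\mathbb R_+\times[0,1]$, $z(t,0)=0$ and $(z_t(t,1),-z_x(t,1))\in\Sigma$ for a.e. $t\in\mathbb R_+$, and $z(0,x)=z_0(x)$, $z_t(0,x)=z_1(x)$ for a.e. $x\in[0,1]$; here $z_t(t,x)=\frac{f(t+x)+g(t-x)}{\sqrt2}$ and $z_x(t,x)=\frac{f(t+x)-g(t-x)}{\sqrt2}$. Set $e_p(z)(t)=\|(z(t,\cdot),z_t(t,\cdot))\|_{\mathsf X_p}$. Damping: a set $\Sigma$ is a damping set if $(0,0)\in\Sigma$, $xy\ge0$ for every $(x,y)\in\Sigma$, and $R\Sigma$ contains the graph of a universally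 measurable function $\varphi:\mathbb R\to\mathbb R$ with linear growth ($|\varphi(x)|\le a|x|+b$ for some $a,b\ge0$). It is strict if moreover $xy>0$ for every $(x,y)\in\Sigma\setminus\{(0,0)\}$. A set-valued map $T:\mathbb R\rightrightarrows\mathbb R$ is called a (strict) damping if its graph equals $R\Sigma'$ for a (strict) damping set $\Sigma'$; equivalently $0\in T(0)$, the graph of $T$ contains the graph of a universally measurable function with linear growth, and $|y|\le|x|$ (for strict: $|y|<|x|$ whenever $(x,y)\ne(0,0)$) for all $x\in\mathbb R$, $y\in T(x)$. A set $M\subset\mathbb R$ is universally measurable if for every Borel probability measure $\nu$ on $\mathbb R$ there exist Borel sets $A\subset M\subset B$ with $\nu(B\setminus A)=0$; $\varphi$ is universally measurable if preimages of Borel sets are universally measurable. (For a damping set, solutions exist for every initial condition in $\mathsf X_p$.) The wave equation is strongly stable in $\mathsf X_p$ if every solution $z$ in $\mathsf X_p$ (for every initial condition in $\mathsf X_p$) satisfies $\lim_{t\to+\infty}e_p(z)(t)=0$. *)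

(* Defs.v *)
From mathcomp Require Import all_boot all_order all_algebra.
From mathcomp Require Import all_classical all_reals all_analysis.
Set Implicit Arguments.
Unset Strict Implicit.
Unset Printing Implicit Defensive.
Import Order.TTheory GRing.Theory Num.Theory.
Import numFieldNormedType.Exports.

Local Open Scope classical_set_scope.
Local Open Scope ring_scope.

(* The matrix R of the rotation by -pi/4, applied to (x, y). *)
Definition rot45 {R : realType} (xy : R * R) : R * R :=
  ((xy.1 + xy.2) / Num.sqrt 2, (xy.2 - xy.1) / Num.sqrt 2).

Definition sv_graph {R : realType} (T : R -> set R) : set (R * R) :=
  [set xy | T xy.1 xy.2].

Definition sv_iter2 {R : realType} (S : R -> set R) : R -> set R :=
  fun x => [set z | exists y, S x y /\ S y z].

Definition univ_measurable_set {R : realType} (M : set R) : Prop :=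
  forall nu : probability (measurableTypeR R) R,
    exists A B : set (measurableTypeR R),
      [/\ measurable A, measurable B, A `<=` M, M `<=` B & nu (B `\` A) = 0%E].

Definition univ_measurable_fun {R : realType} (phi : R -> R) : Prop :=
  forall B : set (measurableTypeR R), measurable B ->
    univ_measurable_set (phi @^-1` B).

Definition linear_growth {R : realType} (phi : R -> R) : Prop :=
  exists a b : R, [/\ 0 <= a, 0 <= b & forall x : R, `|phi x| <= a * `|x| + b].

Definition damping_set {R : realType} (Sigma : set (R * R)) : Prop :=
  [/\ Sigma (0, 0),
      forall x y : R, Sigma (x, y) -> 0 <= x * y &
      exists phi : R -> R, [/\ univ_measurable_fun phi, linear_growth phi &
        forall x : R, (rot45 @` Sigma) (x, phi x)]].

Definition strict_damping_set {R : realType} (Sigma : set (R * R)) : Prop :=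
  damping_set Sigma /\
  forall x y : R, Sigma (x, y) -> (x, y) <> (0, 0) -> 0 < x * y.

Definition strict_damping {R : realType} (T : R -> set R) : Prop :=
  exists Sigma' : set (R * R),
    strict_damping_set Sigma' /\ sv_graph T = rot45 @` Sigma'.

(* Exponents are extended reals and functions on a subset D of the line are
   total functions whose values outside D are ignored, hence the restrictions
   [f \_ D].  Measurable means Borel, which for classes modulo null sets is the
   same as Lebesgue measurable. *)
Definition Lp_on {R : realType} (D : set R) (p : \bar R) (f : R -> R) : Prop :=
  (f \_ D : measurableTypeR R -> R) \in Lfun lebesgue_measure p.

Definition Lp_loc {R : realType} (a : R) (p : \bar R) (f : R -> R) : Prop :=
  forall T : R, a < T -> Lp_on `]a, T[ p f.

(* C^oo functions with compact support in (0, 1). *)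
Definition test_fun01 {R : realType} (phi : R -> R) : Prop :=
  (forall (n : nat) (x : R), derivable (derive1n n phi) x 1) /\
  closure [set x : R | phi x != 0] `<=` `]0, 1[.

Definition weak_deriv01 {R : realType} (u du : R -> R) : Prop :=
  forall phi : R -> R, test_fun01 phi ->
    \int[lebesgue_measure]_(x in `]0, 1[) (u x * derive1 phi x) =
    - \int[lebesgue_measure]_(x in `]0, 1[) (du x * phi x).

(* The boundary value u(0) is that of the continuous representative of u. *)
Definition W1p_star {R : realType} (p : \bar R) (u : R -> R) : Prop :=
  [/\ Lp_on `]0, 1[ p u,
      exists du : R -> R, Lp_on `]0, 1[ p du /\ weak_deriv01 u du &
      exists ubar : R -> R,
        [/\ {within `[0, 1], continuous ubar},
            {ae lebesgue_measure, forall x : R, 0 <= x <= 1 -> u x = ubar x} &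
            ubar 0 = 0]].

Definition in_Xp {R : realType} (p : \bar R) (u v : R -> R) : Prop :=
  W1p_star p u /\ Lp_on `]0, 1[ p v.

(* The norm of (u, v) depends on u only through u', which is passed as [du]. *)
Definition Xp_norm {R : realType} (p : \bar R) (du v : R -> R) : \bar R :=
  match p with
  | r%:E =>
      (((2 `^ (- (r / 2)))%R)%:E *
       \int[lebesgue_measure]_(x in `]0%R, 1%R[)
         ((`|du x + v x| `^ r + `|du x - v x| `^ r)%R)%:E) `^ r^-1
  | +oo =>
      ((Num.sqrt 2)^-1%R)%:E *
      maxe ('N[lebesgue_measure]_+oo [EFin \o ((du \+ v)%R \_ `]0%R, 1%R[)])
           ('N[lebesgue_measure]_+oo [EFin \o ((du \- v)%R \_ `]0%R, 1%R[)])
  | -oo => 0 (* never used: exponents are at least 1 *)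
  end%E.

(* The oriented integral of f from 0 to b, for b of either sign. *)
Definition integral_from0 {R : realType} (f : R -> R) (b : R) : R :=
  \int[lebesgue_measure]_(s in `[0, b]) f s -
  \int[lebesgue_measure]_(s in `[b, 0]) f s.

Definition wave_t {R : realType} (f g : R -> R) (t x : R) : R :=
  (f (t + x) + g (t - x)) / Num.sqrt 2.

Definition wave_x {R : realType} (f g : R -> R) (t x : R) : R :=
  (f (t + x) - g (t - x)) / Num.sqrt 2.

(* z is a weak solution with initial condition (z0, z1), and f, g are the
   functions that witness it; z determines them almost everywhere. *)
Definition wave_solution {R : realType} (Sigma : set (R * R)) (p : \bar R)
    (z0 z1 : R -> R) (z : R -> R -> R) (f g : R -> R) : Prop :=
  [/\ Lp_loc 0 p f /\ Lp_loc (-1) p g,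
      forall t x : R, 0 <= t -> 0 <= x <= 1 ->
        z t x = (Num.sqrt 2)^-1 * integral_from0 f (t + x) +
                (Num.sqrt 2)^-1 * integral_from0 g (t - x),
      {ae lebesgue_measure, forall t : R, 0 <= t ->
        z t 0 = 0 /\ Sigma (wave_t f g t 1, - wave_x f g t 1)} &
      {ae lebesgue_measure, forall x : R, 0 <= x <= 1 ->
        z 0 x = z0 x /\ wave_t f g 0 x = z1 x}].

(* e_p(z)(t), the norm of (z(t, .), z_t(t, .)). *)
Definition energy {R : realType} (p : \bar R) (f g : R -> R) (t : R) : \bar R :=
  Xp_norm p (wave_x f g t) (wave_t f g t).

Definition strongly_stable {R : realType} (Sigma : set (R * R)) (p : \bar R) :
    Prop :=
  forall (z0 z1 : R -> R) (z : R -> R -> R) (f g : R -> R),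
    in_Xp p z0 z1 -> wave_solution Sigma p z0 z1 z f g ->
    energy p f g t @[t --> +oo] --> 0%E.

(* The value on the empty set is -oo; a damping has no empty value. *)
Definition set_norm {R : realType} (A : set R) : \bar R :=
  ereal_sup [set `|a|%:E | a in A].

(* The supremum is nondecreasing in eta, so that the limit exists. *)
Definition rho {R : realType} (T : R -> set R) (r : R) : \bar R :=
  lim (ereal_sup [set set_norm (T x) | x in [set x : R | `|x| <= r + eta]]
       @[eta --> 0^'+]).

(* Main.v *)
Require Import Defs.
From HB Require Import structures.
From mathcomp Require Import all_boot all_order all_algebra.
From mathcomp Require Import all_classical all_reals all_analysis.
From mathcomp Require Import measurable_realfun ess_sup_inf ring lra.
Import Order.TTheory GRing.Theory Num.Theory.
Import numFieldNormedType.Exports.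
Local Open Scope classical_set_scope.
Local Open Scope ring_scope.

(** A solution with witnesses f and g is an orbit of S. The condition at x = 0
    says that the integral of f + g over (0, t) vanishes, hence f = -g almost
    everywhere on the half-line ([wave_solution_reflection]); the condition at
    x = 1, rotated, then reads g(s + 2) in S(g(s)) for almost every s > -1
    ([wave_solution_step]), so that g(s + 4) lies in the iterate S o S of
    g(s). For t >= 1 the energy is the Lp norm of g on (t - 1, t + 1)
    ([energy_finE] for finite p).

    Necessity. The composition of two universally measurable functions is
    universally measurable ([univ_measurable_fun_comp]), and S does not increase
    the modulus, so S o S is a damping. If it is not strict, two steps of S keep
    some nonzero modulus; S has then a cycle of length at most 2 made of
    points of equal modulus ([iter2_isometric_cycle]). The square wave g that
    alternates between these points, with f = -g, yields a solution whose energy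
    does not tend to 0 ([square_wave_solution], [energy_constant_modulus]).

    Sufficiency. Let sigma(r) be the supremum of the moduli of the points of
    (S o S)(x) for |x| <= r. The bound rho(r) < r forces the iterates of sigma
    to tend to 0 ([iter_sup_radius_cvg0]), and |g(s + 4 n)| is at most the n-th
    iterate of sigma at |g(s)| ([wave_solution_le_iter]). For p infinite the
    essential bound of g on one window decreases to 0 in this way
    ([energy_oo_decay]). For p finite g tends to 0 along almost every orbit and
    is dominated by its values on the first window, so that dominated
    convergence applies ([energy_fin_decay]). *)

Set Implicit Arguments.
Unset Strict Implicit.
Unset Printing Implicit Defensive.

(** * The rotation and dampings *)

Section rot45.
Context {R : realType}.
Implicit Types (x y a b : R) (Sigma : set (R * R)) (T S : R -> set R).

Lemma sqrt2_gt0 : 0 < Num.sqrt (2 : R).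
Proof. by rewrite sqrtr_gt0 ltr0n. Qed.

Lemma sqrt2_neq0 : Num.sqrt (2 : R) != 0.
Proof. by rewrite gt_eqF// sqrt2_gt0. Qed.

Lemma sqr_sqrt2 : Num.sqrt (2 : R) * Num.sqrt 2 = 2.
Proof. by rewrite -expr2 sqr_sqrtr// ler0n. Qed.

(** Rotating back turns membership in the image of [Sigma] under the rotation
    into membership in [Sigma]; the sign of the product of the two coordinates
    then compares moduli. *)
Lemma rot45_imageP Sigma a b :
  (rot45 @` Sigma) (a, b) <->
  Sigma ((a - b) / Num.sqrt 2, (a + b) / Num.sqrt 2).
Proof.
have s0 := sqrt2_neq0; have s2 := sqr_sqrt2.
set s := Num.sqrt 2 in s0 s2 *.
have half u : (u + u) / s / s = u.
  by rewrite -mulrA -invfM s2 -mulr2n -[u *+ 2]mulr_natr mulfK ?pnatr_eq0.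
split=> [[[x y] Sxy [<- <-]]|Sab].
  rewrite /rot45/= -/s -mulrBl -mulrDl.
  rewrite (_ : _ - _ = x + x); last by ring.
  by rewrite (_ : _ + _ + _ = y + y) ?half//; ring.
exists ((a - b) / s, (a + b) / s) => //.
rewrite /rot45/= -/s -mulrBl -mulrDl; congr pair.
  by rewrite (_ : _ + _ + _ = a + a) ?half//; ring.
by rewrite (_ : _ - _ = b + b) ?half//; ring.
Qed.

Lemma rot45_prod a b :
  (a - b) / Num.sqrt 2 * ((a + b) / Num.sqrt 2) = (a ^+ 2 - b ^+ 2) / 2.
Proof. by rewrite mulf_div sqr_sqrt2 -subr_sqr. Qed.

Lemma ler_sqr_norm x y : (x ^+ 2 <= y ^+ 2) = (`|x| <= `|y|).
Proof.
rewrite -[x ^+ 2]real_normK ?num_real// -[y ^+ 2]real_normK ?num_real//.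
by rewrite ler_sqr.
Qed.

Lemma ltr_sqr_norm x y : (x ^+ 2 < y ^+ 2) = (`|x| < `|y|).
Proof. by rewrite !ltNge ler_sqr_norm. Qed.

Lemma rot45_prod_ge0 a b :
  (0 <= (a - b) / Num.sqrt 2 * ((a + b) / Num.sqrt 2)) = (`|b| <= `|a|).
Proof.
by rewrite rot45_prod pmulr_lge0 ?invr_gt0 ?ltr0n// subr_ge0 ler_sqr_norm.
Qed.

Lemma rot45_prod_gt0 a b :
  (0 < (a - b) / Num.sqrt 2 * ((a + b) / Num.sqrt 2)) = (`|b| < `|a|).
Proof.
rewrite rot45_prod pmulr_lgt0 ?invr_gt0 ?ltr0n// subr_gt0.
by rewrite ltr_sqr_norm.
Qed.

Definition univ_selection T (phi : R -> R) :=
  [/\ univ_measurable_fun phi, linear_growth phi & forall x, T x (phi x)].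

(** The damping conditions in the rotated coordinates: [S] never increases the
    modulus. *)
Lemma damping_setP Sigma S : sv_graph S = rot45 @` Sigma ->
  damping_set Sigma <->
  [/\ S 0 0, forall a b, S a b -> `|b| <= `|a| &
     exists phi, univ_selection S phi].
Proof.
move=> gS.
have SE a b : S a b <-> Sigma ((a - b) / Num.sqrt 2, (a + b) / Num.sqrt 2).
  by rewrite -rot45_imageP -gS.
split=> [[S0 Sge [phi [mphi lphi Sphi]]]|[S0 Sle [phi [mphi lphi Sphi]]]].
  split; first by apply/SE; rewrite subrr addr0 mul0r.
    by move=> a b /SE/Sge; rewrite rot45_prod_ge0.
  by exists phi; split => // x; rewrite SE -rot45_imageP.
split; first by move/SE : S0; rewrite subrr addr0 mul0r.
- move=> x y Sxy; have : sv_graph S (rot45 (x, y)) by rewrite gS; exists (x, y).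
  have s0 := sqrt2_gt0.
  move=> /Sle /=.
  rewrite !normrM ler_pM2r ?normr_gt0 ?invr_eq0 ?sqrt2_neq0//.
  by rewrite -ler_sqr_norm => ?; nra.
- by exists phi; split => // x; rewrite rot45_imageP; apply/SE.
Qed.

Lemma strict_dampingP T :
  strict_damping T <->
  [/\ T 0 0, forall a b, T a b -> (a, b) <> (0, 0) -> `|b| < `|a| &
     exists phi, univ_selection T phi].
Proof.
split=> [[Sigma' [[damp strict] gT]]|[T0 Tlt Tphi]].
  have [T0 _ Tphi] := (damping_setP gT).1 damp.
  split => // a b Tab ab0; rewrite -rot45_prod_gt0; apply: strict.
    by rewrite -rot45_imageP -gT.
  move=> [/eqP + /eqP]; rewrite !mulf_eq0 !invr_eq0 !(negbTE sqrt2_neq0) !orbF.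
  by move=> /eqP h1 /eqP h2; apply: ab0; congr pair; lra.
pose Sigma' := [set xy : R * R | sv_graph T (rot45 xy)].
have gT : sv_graph T = rot45 @` Sigma'.
  apply/seteqP; split => [[a b] Tab|_ [xy Txy <-]//].
  rewrite rot45_imageP /Sigma' /=.
  suff -> : rot45 ((a - b) / Num.sqrt 2, (a + b) / Num.sqrt 2) = (a, b) by [].
  have [xy <- ->] :
      (rot45 @` [set ((a - b) / Num.sqrt 2, (a + b) / Num.sqrt 2)]) (a, b).
    by rewrite rot45_imageP.
  by [].
exists Sigma'; split => //; split.
  apply/(damping_setP gT); split => // a b Tab.
  by have [[-> ->]//|ab0] := pselect ((a, b) = (0, 0)); exact/ltW/Tlt.
move=> x y Sxy xy0.
have Txy : T ((x + y) / Num.sqrt 2) ((y - x) / Num.sqrt 2) by [].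
have := Tlt _ _ Txy; rewrite -rot45_prod_gt0 rot45_prod.
have s0 := sqrt2_gt0.
rewrite !exprMn exprVn sqr_sqrtr// => H.
have : (x + y) ^+ 2 / 2 - (y - x) ^+ 2 / 2 = x * y * 2 by field.
move=> E; move: H; rewrite E mulfK// ?pnatr_eq0//; apply.
move=> [/eqP + /eqP]; rewrite !mulf_eq0 !invr_eq0 !(negbTE sqrt2_neq0) !orbF.
by move=> /eqP h1 /eqP h2; apply: xy0; congr pair; lra.
Qed.

End rot45.

(** * Composition of universally measurable functions *)

Section univ_measurable.
Context {R : realType}.
Local Notation MR := (measurableTypeR R).

(** It is enough to sandwich the countably many sets where phi is below a
    rational number: outside the union N of the differences between the outer
    and the inner Borel sets, each of them coincides with a Borel set. *)
Lemma univ_measurable_fun_ae (phi : R -> R) (nu : probability MR R) :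
  univ_measurable_fun phi ->
  exists (h : MR -> MR) (N : set MR),
    [/\ measurable_fun [set: MR] h, measurable N, nu N = 0%E &
      forall x, ~ N x -> phi x = h x].
Proof.
move=> mphi.
have mray (q : rat) : measurable (`]-oo, ratr q[%classic : set MR).
  exact: measurable_itv.
have /choice[AB HAB] q : exists AB : set MR * set MR,
    [/\ measurable AB.1, measurable AB.2, AB.1 `<=` [set x | phi x < ratr q],
        [set x | phi x < ratr q] `<=` AB.2 & nu (AB.2 `\` AB.1) = 0%E].
  have [A [B [mA mB AM MB AB0]]] := mphi _ (mray q) nu.
  by exists (A, B); split.
pose D n : set MR :=
  if unpickle n is Some q then (AB q).2 `\` (AB q).1 else set0.
have mD n : measurable (D n).
  rewrite /D; case: unpickle => // q.
  by have [mA mB _ _ _] := HAB q; exact: measurableD.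
have D0 n : nu.-negligible (D n).
  apply/negligibleP => //; rewrite /D; case: unpickle => // q.
  by have [] := HAB q.
have mN : measurable (\bigcup_n D n) by exact: bigcupT_measurable.
(* The Borel representative is phi outside N and 0 on N. *)
exists (phi \_ (~` \bigcup_n D n)), (\bigcup_n D n); split => //; last 2 first.
- by apply: measure_negligible => //; exact: negligible_bigcup.
- by move=> x Nx; rewrite patchE mem_set.
move=> _; apply: (measurability _ (RGenInftyO.measurableE R)) => //.
move=> _ [_ [a ->] <-]; rewrite setTI.
set N := \bigcup_n D n in mN *.
rewrite (_ : _ @^-1` _ = (if 0 < a then N else set0) `|`
    \bigcup_q (if ratr q < a then (AB q).1 `\` N else set0)); last first.
  apply/seteqP; split => x /=; rewrite in_itv/= patchE.
    have [Nx|Nx] := pselect (N x).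
      by rewrite memNset; [move=> a0; left; rewrite a0|move=> /(_ Nx)].
    rewrite mem_set// => xa; right.
    have [q] := rat_in_itvoo xa; rewrite in_itv/= => /andP[xq qa].
    exists q => //=; rewrite qa; split => //; apply: contrapT => nA; apply: Nx.
    have [_ _ _ MB _] := HAB q.
    exists (pickle q); first exact: I.
    by rewrite /D pickleK; split; [exact: MB|exact: nA].
  case=> [|[q _]].
    by case: ifPn => // a0 Nx; rewrite memNset// => /(_ Nx).
  case: ifPn => // qa [Aq Nx].
  rewrite mem_set//; have [_ _ AM _ _] := HAB q.
  by have := AM _ Aq; move=> /lt_trans; exact.
apply: measurableU; first by case: ifP.
apply: bigcupT_measurable_rat => q; case: ifP => // _.
by apply: measurableD => //; have [] := HAB q.
Qed.

(** A probability nu cannot be pushed forward by phi, which is not Borel, but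
    it can be pushed forward by a Borel function equal to phi nu-almost
    everywhere; the universal measurability of psi is used for that image. *)
Lemma univ_measurable_fun_comp (phi psi : R -> R) :
  univ_measurable_fun phi -> univ_measurable_fun psi ->
  univ_measurable_fun (psi \o phi).
Proof.
move=> mphi mpsi C mC nu.
have [h [N [mh mN N0 phih]]] := univ_measurable_fun_ae nu mphi.
have mpre (E : set MR) : measurable E -> measurable (h @^-1` E).
  by move=> mE; rewrite -[_ @^-1` _]setTI; exact: mh.
pose X : {mfun MR >-> MR} := HB.pack h (isMeasurableFun.Build _ _ _ _ _ mh).
have [A [B [mA mB AM MB AB0]]] := mpsi _ mC (distribution nu X).
exists (h @^-1` A `\` N), (h @^-1` B `|` N); split.
- by apply: measurableD => //; exact: mpre.
- by apply: measurableU => //; exact: mpre.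
- by move=> x [Ahx Nx]; rewrite /= /preimage/= phih//; exact: AM.
- move=> x /= Cx; have [Nx|Nx] := pselect (N x); first by right.
  by left; apply: MB; rewrite /preimage/= -phih.
apply/negligibleP.
  apply: measurableD; [apply: measurableU|apply: measurableD] => //;
    exact: mpre.
apply: (@negligibleS _ _ _ _ (h @^-1` (B `\` A) `|` N)).
  move=> x [[Bx|Nx] nAN]; last by right.
  have [Nx|Nx] := pselect (N x); first by right.
  by left; split => // Ax; apply: nAN.
apply: negligibleU; apply/negligibleP => //.
by apply: mpre; exact: measurableD.
Qed.

Lemma linear_growth_comp (phi psi : R -> R) :
  linear_growth phi -> linear_growth psi -> linear_growth (psi \o phi).
Proof.
move=> [a [b [a0 b0 phile]]] [c [d [c0 d0 psile]]].
exists (c * a), (c * b + d); split; rewrite ?mulr_ge0 ?addr_ge0 ?mulr_ge0//.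
move=> x; rewrite (le_trans (psile _))// addrA lerD2r -mulrA -mulrDr.
by rewrite ler_wpM2l.
Qed.

End univ_measurable.

(** * Iterating the worst-case modulus *)

Section sup_radius.
Context {R : realType}.
Variable T : R -> set R.
Hypothesis T00 : T 0 0.
Hypothesis Tle : forall x y, T x y -> `|y| <= `|x|.

(** The function rho is the right limit of this supremum, which is real because
    [T] does not increase the modulus. *)
Definition sup_radius (r : R) : R :=
  sup [set `|y| | y in [set y | exists2 x, `|x| <= r & T x y]].

Local Notation E r := [set `|y| | y in [set y | exists2 x, `|x| <= r & T x y]].

Let has_supE r : 0 <= r -> has_sup (E r).
Proof.
move=> r0; split; first by exists `|0 : R|, 0 => //; exists 0; rewrite ?normr0.
by exists r => _ [y [x xr Txy] <-]; exact: le_trans (Tle Txy) xr.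
Qed.

Lemma le_sup_radius x y r : `|x| <= r -> T x y -> `|y| <= sup_radius r.
Proof.
move=> xr Txy; apply: sup_upper_bound; first by apply/has_supE/(le_trans _ xr).
by exists y => //; exists x.
Qed.

Lemma sup_radius_ge0 r : 0 <= r -> 0 <= sup_radius r.
Proof.
by move=> r0; have := @le_sup_radius 0 0 r; rewrite normr0; exact.
Qed.

Lemma sup_radius_le r s : 0 <= r ->
  (forall x y, `|x| <= r -> T x y -> `|y| <= s) -> sup_radius r <= s.
Proof.
move=> r0 Ts; apply: ge_sup; first exact: (has_supE r0).1.
by move=> _ [y [x xr Txy] <-]; exact: Ts Txy.
Qed.

Lemma sup_radius_le_id r : 0 <= r -> sup_radius r <= r.
Proof.
by move=> r0; apply: sup_radius_le => // x y xr /Tle yx; exact: le_trans xr.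
Qed.

Lemma sup_radius_homo r s : 0 <= r -> r <= s -> sup_radius r <= sup_radius s.
Proof.
move=> r0 rs; apply: sup_radius_le => // x y xr Txy.
by apply: le_sup_radius Txy; exact: le_trans rs.
Qed.

Lemma iter_sup_radius_ge0 n r : 0 <= r -> 0 <= iter n sup_radius r.
Proof. by move=> r0; elim: n => //= n IH; exact: sup_radius_ge0. Qed.

Lemma iter_sup_radius_homo n r s : 0 <= r -> r <= s ->
  iter n sup_radius r <= iter n sup_radius s.
Proof.
move=> r0 rs; elim: n => //= n IH; apply: sup_radius_homo => //.
exact: iter_sup_radius_ge0.
Qed.

Lemma iter_sup_radius_le n m r : 0 <= r -> (n <= m)%N ->
  iter m sup_radius r <= iter n sup_radius r.
Proof.
move=> r0 /subnK <-; elim: (m - n)%N => // k IH; rewrite addSn /=.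
by apply: le_trans IH; apply: sup_radius_le_id; exact: iter_sup_radius_ge0.
Qed.

(** As rho is a limit from the right, a strict bound on it at [r] extends to a
    radius larger than [r]. *)
Lemma rho_lt_sup_radius r : 0 < r -> (rho T r < r%:E)%E ->
  exists2 s, r < s & sup_radius s < r.
Proof.
move=> r0 rhor; apply: contrapT => noeta.
move: rhor; rewrite ltNge => /negP; apply; rewrite /rho.
apply: lime_ge.
  apply: nondecreasing_at_right_is_cvge; near=> e => a b _ _ ab.
  apply: le_ereal_sup => _ [x /= xa <-]; exists x => //=.
  by rewrite (le_trans xa)// lerD2l.
near=> eta.
have eta0 : 0 < eta by near: eta; exact: nbhs_right_gt.
rewrite leNgt; apply/negP => Fr; apply: noeta; exists (r + eta).
  by rewrite ltrDl.
move: Fr; set F := ereal_sup _ => Fr.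
have TF x y : `|x| <= r + eta -> T x y -> (`|y|%:E <= F)%E.
  move=> xr Txy; apply: (@le_trans _ _ (set_norm (T x))).
    by apply: ereal_sup_ubound; exists y.
  by apply: ereal_sup_ubound; exists x.
have re0 : 0 <= r + eta by rewrite addr_ge0 ?ltW.
have F0 : (0 <= F)%E by have := TF 0 0; rewrite normr0; exact.
have Ffin : F \is a fin_num by rewrite ge0_fin_numE// (lt_trans Fr) ?ltry.
rewrite -(fineK Ffin) lte_fin in Fr; apply: le_lt_trans Fr.
by apply: sup_radius_le => // x y xr Txy; rewrite -lee_fin fineK// (TF x).
Unshelve. all: by end_near. Qed.

(** The iterates decrease to some l. If l were positive, an iterate would fall
    below a radius s > l whose image under sup_radius is already below l. *)
Lemma iter_sup_radius_cvg0 r e :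
  (forall s, 0 < s -> (rho T s < s%:E)%E) -> 0 <= r -> 0 < e ->
  exists n, iter n sup_radius r <= e.
Proof.
move=> rholt r0 e0.
pose A := range (fun n => iter n sup_radius r).
have A0 : has_inf A.
  split; first by exists r, 0%N.
  by exists 0 => _ [n _ <-]; exact: iter_sup_radius_ge0.
have infle n : inf A <= iter n sup_radius r.
  by apply: ge_inf; [exact: A0.2|exists n].
have [l0|l0] := leP (inf A) 0.
  have [_ [n _ <-] ne] := inf_adherent e0 A0.
  by exists n; rewrite ltW// (lt_le_trans ne)// gerDr.
have [s ls sl] := rho_lt_sup_radius l0 (rholt _ l0).
have sl0 : 0 < s - inf A by rewrite subr_gt0.
have [_ [n _ <-]] := inf_adherent sl0 A0; rewrite subrKC => ns.
have := infle n.+1; rewrite leNgt => /negP[]; apply: le_lt_trans sl.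
by apply: sup_radius_homo; [exact: iter_sup_radius_ge0|exact: ltW].
Qed.

End sup_radius.

(** * Invariance of the Lebesgue measure *)

Section lebesgue_preserving.
Context {R : realType}.
Local Notation MR := (measurableTypeR R).
Local Notation mu := (@lebesgue_measure R).

Definition lebesgue_preserving (phi : MR -> MR) :=
  measurable_fun [set: MR] phi /\
  forall A : set MR, measurable A -> mu (phi @^-1` A) = mu A.

(** The half-open intervals determine the Lebesgue measure. *)
Lemma lebesgue_preserving_itv (phi : MR -> MR) :
  measurable_fun [set: MR] phi ->
  (forall a b : R, mu (phi @^-1` `]a, b]) = mu `]a, b]) ->
  lebesgue_preserving phi.
Proof.
move=> mphi phiE; split=> // A mA.
apply/esym/(@lebesgue_measure_unique _ (pushforward mu phi) _ A mA).
by move=> _ [[a b] _ <-] /=; exact/esym/phiE.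
Qed.

Lemma lebesgue_preserving_translation (c : R) :
  lebesgue_preserving (fun x => c + x).
Proof.
apply: lebesgue_preserving_itv => [|a b]; first exact: measurable_funD.
rewrite (_ : _ @^-1` _ = `]a - c, b - c]%classic); last first.
  by apply/seteqP; split => x; rewrite /= !in_itv/= ltrBlDl lerBrDl.
rewrite !lebesgue_measure_itv/= !lte_fin ltrD2r; case: ifP => // _.
by rewrite -!EFinB; congr EFin; ring.
Qed.

Lemma lebesgue_preserving_reflection (c : R) :
  lebesgue_preserving (fun x => c - x).
Proof.
apply: lebesgue_preserving_itv => [|a b]; first exact: measurable_funB.
rewrite (_ : _ @^-1` _ = `[c - b, c - a[%classic); last first.
  apply/seteqP; split => x; rewrite /= !in_itv/= andbC;
    by rewrite lerBlDr lerBlDl ltrBrDl ltrBrDr.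
rewrite !lebesgue_measure_itv/= !lte_fin ltrD2l ltrN2; case: ifP => // _.
by rewrite -!EFinB; congr EFin; ring.
Qed.

Lemma ae_lebesgue_preserving (phi : MR -> MR) (P : R -> Prop) :
  lebesgue_preserving phi ->
  {ae mu, forall x, P x} -> {ae mu, forall x, P (phi x)}.
Proof.
move=> [mphi phiE] [A [mA A0 PA]]; exists (phi @^-1` A); split.
- by rewrite -[_ @^-1` _]setTI; exact: mphi.
- by rewrite phiE.
- by move=> x nP; apply: PA.
Qed.

Lemma ge0_integral_lebesgue_preserving (phi : MR -> MR) (D : set MR)
    (f : MR -> \bar R) :
  lebesgue_preserving phi -> measurable D -> measurable_fun D f ->
  (forall x, D x -> 0 <= f x)%E ->
  (\int[mu]_(x in D) f x = \int[mu]_(x in phi @^-1` D) f (phi x))%E.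
Proof.
move=> [mphi phiE] mD mf f0.
rewrite -(ge0_integral_pushforward mphi)//; last by move=> x /[!inE] /f0.
apply: eq_measure_integral => A mA _; exact/esym/phiE.
Qed.

End lebesgue_preserving.

(** * Functions with a vanishing primitive *)

Section vanishing_primitive.
Context {R : realType}.
Local Notation mu := (@lebesgue_measure R).

Lemma ae_imply (P Q : R -> Prop) : (forall x, P x -> Q x) ->
  {ae mu, forall x, P x} -> {ae mu, forall x, Q x}.
Proof. by move=> PQ; apply: (@filterS _ _ (ae_filter_ringOfSetsType mu)). Qed.

Lemma ae_imply2 (P Q W : R -> Prop) : (forall x, P x -> Q x -> W x) ->
  {ae mu, forall x, P x} -> {ae mu, forall x, Q x} -> {ae mu, forall x, W x}.
Proof. by move=> PQ; apply: (@filterS2 _ _ (ae_filter_ringOfSetsType mu)). Qed.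

Lemma ae_itv_exists (P : R -> Prop) (a b : R) :
  {ae mu, forall x, P x} -> a < b -> exists2 x, a < x < b & P x.
Proof.
move=> [A [mA A0 PA]] ab; apply: contrapT => nP.
have abA : `]a, b[ `<=` A.
  move=> x /=; rewrite in_itv/= => xab; apply: PA => Px.
  by apply: nP; exists x.
have : (mu `]a, b[ <= mu A)%E by apply: le_measure; rewrite ?inE.
rewrite A0 lebesgue_measure_itv/= lte_fin ab -EFinB lee_fin subr_le0.
by rewrite leNgt ab.
Qed.

(** A nonzero derivative at a zero of [F] would make [x] an isolated zero, while
    the zeros of [F] are dense to the right of [x]. *)
Lemma derive1_ae_eq0 (F : R -> R) (x b : R) :
  {ae mu, forall t, x < t < b -> F t = 0} -> x < b -> F x = 0 ->
  derivable F x 1 -> derive1 F x = 0.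
Proof.
move=> F0 xb Fx dF; apply/eqP/negPn/negP => c0.
have dq : h^-1 *: (F (h + x) - F x) @[h --> 0^'] --> derive1 F x.
  rewrite /derive1; apply/cvg_ex; move: dF => /cvg_ex[l dF]; exists l.
  apply: cvg_trans dF; apply: near_eq_cvg; near=> h => /=.
  by rewrite [h *: 1]mulr1.
have : \forall h \near 0^', h^-1 *: (F (h + x) - F x) != 0.
  exact: cvgr_neq0 dq c0.
move=> [/= e e0 he].
pose y := Num.min b (x + e).
have xy : x < y by rewrite lt_min xb ltrDl e0.
have [t /andP[xt ty] Ft] := ae_itv_exists F0 xy.
move: ty; rewrite lt_min => /andP[tb te].
have h1 : ball 0 e (t - x).
  by rewrite /ball/= sub0r normrN gtr0_norm ?subr_gt0// ltrBlDl.
have h2 : t - x != 0 by rewrite subr_eq0 gt_eqF.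
by have := he _ h1 h2; rewrite subrK Fx subr0 Ft ?xt// scaler0 eqxx.
Unshelve. all: by end_near. Qed.

(** By Lebesgue differentiation, [h] is almost everywhere the derivative of its
    primitive. *)
Lemma ae0_of_integral_itv0 (h : R -> R) :
  (forall T : R, 0 < T -> mu.-integrable `]0, T[ (EFin \o h)) ->
  {ae mu, forall t : R, 0 < t -> \int[mu]_(s in `]0, t]) h s = 0} ->
  {ae mu, forall t : R, 0 < t -> h t = 0}.
Proof.
move=> ih H0.
pose hn n : R -> R := h \_ `]0, n.+1%:R[.
have ihn n : mu.-integrable [set: R] (EFin \o hn n).
  have /(integrable_mkcond _ _).1 := ih n.+1%:R (ltr0Sn _ _).
  by rewrite restrict_EFin; apply; exact: measurable_itv.
suff Hn n : {ae mu, forall t : R, 0 < t < n.+1%:R -> h t = 0}.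
  apply: ae_imply (ae_foralln Hn) => t Ht t0.
  apply: (Ht (Num.truncn t)); rewrite t0/=; exact: truncnS_gt.
have iy (y : R) :
    mu.-integrable [set` Interval (BLeft 0) (BRight y)] (EFin \o hn n).
  exact: integrableS (ihn n).
have locf : locally_integrable [set: R] (hn n).
  by apply: open_integrable_locally => //; exact: openT.
pose F t := \int[mu]_(s in `[0, t]) hn n s.
have F0 : {ae mu, forall t, 0 < t < n.+1%:R -> F t = 0}.
  apply: ae_imply H0 => t Ht /andP[t0 tn]; rewrite -(Ht t0) /F.
  rewrite -Rintegral_itv_obnd_cbnd; last first.
    exact: integrableS (ihn n).
  apply: eq_Rintegral => s; rewrite inE/= in_itv/= => /andP[s0 st].
  by rewrite /hn patchE mem_set//= in_itv/= s0 (le_lt_trans st).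
apply: (ae_imply2 _ (FTC1 iy locf) F0) => t dFt Ft /andP[t0 tn].
have [|dF dFE] := dFt; first by rewrite lte_fin.
have <- : hn n t = h t by rewrite /hn patchE mem_set//= in_itv/= t0.
rewrite -dFE; apply: (derive1_ae_eq0 _ tn _ dF); last by apply: Ft; rewrite t0.
apply: ae_imply F0 => s Fs /andP[ts sn]; apply: Fs.
by rewrite sn (lt_trans t0).
Qed.

End vanishing_primitive.

(** * Functions in Lp on a set *)

Section Lp_on.
Context {R : realType}.
Local Notation MR := (measurableTypeR R).
Local Notation mu := (@lebesgue_measure R).
Implicit Types (D : set MR) (f : R -> R) (p : \bar R).

Lemma lebesgue_measureT_gt0 : (0 < mu [set: MR])%E.
Proof. by rewrite -set_itvNyy lebesgue_measure_itv/= ltry. Qed.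

Lemma Lp_on_measurable D p f : measurable D -> Lp_on D p f ->
  measurable_fun (D : set MR) (f : MR -> MR).
Proof.
move=> mD /sub_Lfun_mfun; rewrite inE/= => mf.
exact/(measurable_restrictT _ mD).
Qed.

Lemma Lp_on_integrable_powR D r f : measurable D -> 1 <= r ->
  Lp_on D r%:E f -> mu.-integrable D (fun x => (`|f x| `^ r)%:E).
Proof.
move=> mD r1 /Lfun_integrable => /(_ r1).
move=> /(integrableS measurableT mD (@subsetT _ D)).
by apply: eq_integrable => // x /[!inE] Dx; rewrite patchE mem_set.
Qed.

Lemma Lp_on_oo_ae_bounded D f : Lp_on D +oo%E f ->
  exists2 M, 0 <= M & {ae mu, forall x, D x -> `|f x| <= M}.
Proof.
move=> /sub_Lfun_finLfun; rewrite inE /= /finite_norm unlock.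
rewrite lebesgue_measureT_gt0 => /ess_supr_bounded[M HM].
exists (Num.max 0 M); first by rewrite le_max lexx.
apply: ae_imply HM => x /= + Dx; rewrite patchE mem_set// le_max => ->.
by rewrite orbT.
Qed.

(** For a finite exponent r, |f| <= 1 + |f|^r. *)
Lemma Lp_on_integrable D p f : measurable D -> (mu D < +oo)%E -> (1 <= p)%E ->
  Lp_on D p f -> mu.-integrable D (EFin \o f).
Proof.
move=> mD Doo; case: p => [r||]; rewrite ?lee_fin//.
- move=> r1 fLp; have mf := Lp_on_measurable mD fLp.
  have ifr := Lp_on_integrable_powR mD r1 fLp.
  have i1 : mu.-integrable D (EFin \o cst 1).
    by apply: measurable_bounded_integrable => //; exact: bounded_cst.
  apply: (le_integrable mD _ _ (integrableD mD i1 ifr)).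
    exact/measurable_EFinP.
  move=> x Dx /=; rewrite lee_fin [leRHS]ger0_norm ?addr_ge0 ?powR_ge0//.
  have [f1|f1] := leP `|f x| 1; first by rewrite (le_trans f1)// lerDl powR_ge0.
  rewrite (@le_trans _ _ (`|f x| `^ r))//; last by rewrite lerDr.
  by rewrite -[leLHS]powRr1// ler_powR// ltW.
- move=> _ fLp; have mf := Lp_on_measurable mD fLp.
  have [M M0 fM] := Lp_on_oo_ae_bounded fLp.
  have mf' : measurable_fun D (EFin \o f) by exact/measurable_EFinP.
  apply/integrableP; split => //.
  apply: (@le_lt_trans _ _ (M%:E * mu D)%E).
    apply: integral_le_bound => //; rewrite ?lee_fin//.
  by rewrite lte_mul_pinfty// lee_fin.
Qed.

End Lp_on.

(** * Solutions as orbits of the set-valued map *)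

Section wave_solution.
Context {R : realType}.
Local Notation mu := (@lebesgue_measure R).
Variables (Sigma : set (R * R)) (S : R -> set R) (p : \bar R).
Hypothesis gS : sv_graph S = rot45 @` Sigma.
Hypothesis p1 : (1 <= p)%E.
Variables (z0 z1 : R -> R) (z : R -> R -> R) (f g : R -> R).
Hypothesis sol : wave_solution Sigma p z0 z1 z f g.

Lemma integral_from0_itv (h : R -> R) (t : R) : 0 < t ->
  mu.-integrable `]0, t] (EFin \o h) ->
  integral_from0 h t = \int[mu]_(s in `]0, t]) h s.
Proof.
move=> t0 ih; rewrite /integral_from0.
rewrite [`[t, 0]%classic]set_itv_ge ?bnd_simp -?ltNge//.
by rewrite Rintegral_set0 subr0 -Rintegral_itv_obnd_cbnd.
Qed.

Lemma wave_solution_integrable (T : R) : 0 < T ->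
  mu.-integrable `]0, T[ (EFin \o f) /\ mu.-integrable `]0, T[ (EFin \o g).
Proof.
have [[fp gp] _ _ _] := sol => T0; split.
  apply: (Lp_on_integrable _ _ p1 (fp T T0)) => //.
  by rewrite lebesgue_measure_itv/= lte_fin T0 -EFinB ltry.
have T1 : -1 < T by rewrite (lt_trans _ T0)// ltrN10.
apply: (@integrableS _ _ _ mu `]-1, T[%classic) => //.
  by apply: subset_itvr; rewrite bnd_simp lerN10.
apply: (Lp_on_integrable _ _ p1 (gp T T1)) => //.
by rewrite lebesgue_measure_itv/= lte_fin T1 -EFinB ltry.
Qed.

(** The condition z(t, 0) = 0 says that f + g has a vanishing primitive. *)
Lemma wave_solution_reflection : {ae mu, forall t : R, 0 < t -> f t = - g t}.
Proof.
have [_ zE bnd _] := sol.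
suff : {ae mu, forall t : R, 0 < t -> f t + g t = 0}.
  by apply: ae_imply => t H /H /eqP; rewrite addr_eq0 => /eqP.
apply: ae0_of_integral_itv0 => [T T0|].
  have [fi gi] := wave_solution_integrable T0.
  have := @integrableD _ _ _ mu _ _ _ _ fi gi; apply => //.
apply: ae_imply bnd => t Ht t0; have [zt0 _] := Ht (ltW t0).
have [fi gi] := @wave_solution_integrable (t + 1) (addr_gt0 t0 ltr01).
have sub : `]0, t] `<=` `]0, t + 1[.
  by apply: subset_itvl; rewrite bnd_simp ltrDl.
have fi' : mu.-integrable `]0, t] (EFin \o f) by exact: integrableS fi.
have gi' : mu.-integrable `]0, t] (EFin \o g) by exact: integrableS gi.
rewrite RintegralD// -!integral_from0_itv//.
have := zE t 0 (ltW t0); rewrite lexx ler01 addr0 subr0 zt0 => /(_ isT).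
move=> /esym/eqP; rewrite -mulrDr mulf_eq0 invr_eq0 (negbTE sqrt2_neq0)/=.
by move=> /eqP.
Qed.

(** The boundary condition at x = 1, rotated, puts -f(t + 1) in S(g(t - 1)); the
    reflection at x = 0 replaces -f(t + 1) by g(t + 1). *)
Lemma wave_solution_step :
  {ae mu, forall s : R, -1 < s -> S (g s) (g (s + 2))}.
Proof.
have [_ _ bnd _] := sol.
have tr c := @lebesgue_preserving_translation R c.
have H1 := ae_lebesgue_preserving (tr 1) bnd.
have H2 := ae_lebesgue_preserving (tr 2) wave_solution_reflection.
apply: ae_imply2 H1 H2 => s H1 H2 s1.
have s10 : 0 <= 1 + s by lra.
have [_] := H1 s10.
rewrite /wave_t /wave_x.
have -> : 1 + s + 1 = 2 + s by ring.
have -> : 1 + s - 1 = s by ring.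
have f2 : f (2 + s) = - g (2 + s) by apply: H2; lra.
rewrite [s + 2]addrC f2 => Sig.
change (sv_graph S (g s, g (2 + s))); rewrite gS rot45_imageP.
move: Sig; congr (Sigma (_, _)); first by rewrite addrC.
by rewrite -mulNr opprB opprK.
Qed.

(** A null set of exceptions for one step has countably many translates, whose
    union is null. *)
Lemma wave_solution_steps :
  {ae mu, forall s : R, -1 < s -> forall n : nat,
    sv_iter2 S (g (s + n%:R * 4)) (g (s + n.+1%:R * 4))}.
Proof.
suff H n : {ae mu, forall s : R, -1 < s ->
    sv_iter2 S (g (s + n%:R * 4)) (g (s + n.+1%:R * 4))}.
  by apply: ae_imply (ae_foralln H) => s Hs s1 n; exact: Hs.
have tr c := @lebesgue_preserving_translation R c.
have H1 := ae_lebesgue_preserving (tr (n%:R * 4)) wave_solution_step.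
have H2 := ae_lebesgue_preserving (tr (n%:R * 4 + 2)) wave_solution_step.
apply: ae_imply2 H1 H2 => s H1 H2 s1.
have n0 : 0 <= n%:R * 4 :> R by rewrite mulr_ge0.
exists (g (n%:R * 4 + s + 2)); split.
  by rewrite [s + _]addrC; apply: H1; lra.
have -> : s + n.+1%:R * 4 = n%:R * 4 + 2 + s + 2 by rewrite -natr1; ring.
have -> : n%:R * 4 + s + 2 = n%:R * 4 + 2 + s by ring.
by apply: H2; lra.
Qed.

End wave_solution.

(** * Energy *)

Section energy.
Context {R : realType}.
Local Notation MR := (measurableTypeR R).
Local Notation mu := (@lebesgue_measure R).
Local Notation I01 := (`](0 : R), (1 : R)[%classic : set MR).
Implicit Types (f g : R -> R) (t x : R) (p : \bar R).

Lemma norm_wave_xDt f g t x :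
  `|wave_x f g t x + wave_t f g t x| = Num.sqrt 2 * `|f (t + x)|.
Proof.
rewrite /wave_x /wave_t -mulrDl (_ : _ + _ = f (t + x) * 2); last by ring.
rewrite -mulrA -{1}sqr_sqrt2 mulfK ?sqrt2_neq0// normrM mulrC; congr (_ * _).
exact/ger0_norm/sqrtr_ge0.
Qed.

Lemma norm_wave_xBt f g t x :
  `|wave_x f g t x - wave_t f g t x| = Num.sqrt 2 * `|g (t - x)|.
Proof.
rewrite /wave_x /wave_t -mulrBl (_ : _ - _ = - g (t - x) * 2); last by ring.
rewrite -mulrA -{1}sqr_sqrt2 mulfK ?sqrt2_neq0// normrM normrN mulrC.
congr (_ * _); exact/ger0_norm/sqrtr_ge0.
Qed.

Lemma le_poweRD (u v w : \bar R) (s : R) : 0 <= s ->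
  (0 <= u)%E -> (0 <= v)%E -> (u <= w)%E -> (v <= w)%E ->
  ((u + v) `^ s <= (w + w) `^ s)%E.
Proof.
move=> s0 u0 v0 uw vw; have w0 : (0 <= w)%E by exact: le_trans uw.
apply: gt0_ler_poweR => //; rewrite ?in_itv/= ?leey ?andbT ?adde_ge0//.
exact: leeD.
Qed.

Lemma energy_ge0 p f g t : (0 <= energy p f g t)%E.
Proof.
rewrite /energy /Xp_norm; case: p => [r||//]; first exact: poweR_ge0.
by rewrite mule_ge0 ?lee_fin ?invr_ge0 ?sqrtr_ge0// le_max Lnorm_ge0.
Qed.

Lemma measurable_norm_powR_comp (D E : set MR) (phi : MR -> MR) (h : R -> R)
    (r : R) :
  measurable E -> (forall x, D x -> E (phi x)) ->
  measurable_fun E (h : MR -> MR) -> measurable_fun D phi ->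
  measurable_fun D (fun x => (`|h (phi x)| `^ r)%:E).
Proof.
move=> mE DE mh mphi; apply/measurable_EFinP.
apply: (measurableT_comp (measurable_powR _)).
apply: measurableT_comp => //; apply: (measurable_comp mE) mh mphi.
by move=> _ [x Dx <-]; exact: DE.
Qed.

(** The normalizing factor of the norm cancels the factor sqrt 2 in
    z_x + z_t = sqrt 2 f(t + x) and in z_x - z_t = - sqrt 2 g(t - x). *)
Lemma energy_finE (r : R) f g t : 1 <= r ->
  measurable_fun I01 (fun x : MR => (`|f (t + x)| `^ r)%:E) ->
  measurable_fun I01 (fun x : MR => (`|g (t - x)| `^ r)%:E) ->
  (energy r%:E f g t = (\int[mu]_(x in I01) (`|f (t + x)| `^ r)%:E +
                        \int[mu]_(x in I01) (`|g (t - x)| `^ r)%:E) `^ r^-1)%E.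
Proof.
move=> r1 mf mg; rewrite /energy /Xp_norm; congr (_ `^ _)%E.
have c0 : 0 <= Num.sqrt 2 `^ r :> R by exact: powR_ge0.
rewrite -ge0_integralD//.
transitivity ((2 `^ (- (r / 2)))%:E * ((Num.sqrt 2 `^ r)%:E *
    \int[mu]_(x in I01) ((`|f (t + x)| `^ r)%:E + (`|g (t - x)| `^ r)%:E)))%E.
  congr (_ * _)%E; rewrite -ge0_integralZl//.
  - apply: eq_integral => x _.
    rewrite norm_wave_xDt norm_wave_xBt !powRM ?sqrtr_ge0//.
    by rewrite -mulrDr EFinM EFinD.
  - exact: emeasurable_funD.
  - by move=> x _; rewrite adde_ge0// lee_fin powR_ge0.
rewrite muleA -EFinM -powR12_sqrt// -powRrM powRN [2^-1 * r]mulrC mulVf//.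
by rewrite mul1e.
Qed.

(** Time is cut into periods of length 4, the time that two steps of the
    orbit take. *)
Lemma energy_cvg0 p f g :
  (forall e : R, 0 < e -> exists n0 : nat, forall (n : nat) t, (n0 <= n)%N ->
    1 <= t -> n%:R * 4 <= t -> t < n%:R * 4 + 4 ->
    (energy p f g t <= e%:E)%E) ->
  energy p f g t @[t --> +oo] --> 0%E.
Proof.
move=> H.
have {}H e : 0 < e ->
    exists T : R, forall t, T <= t -> (energy p f g t <= e%:E)%E.
  move=> /H[n0 Hn0]; exists (1 + n0%:R * 4) => t Tt.
  have n00 : 0 <= n0%:R :> R by [].
  have t0 : 0 <= t / 4 by rewrite divr_ge0//; lra.
  have /andP[nt tn] := truncn_itv t0.
  have n0n : (n0 <= Num.truncn (t / 4))%N.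
    by rewrite truncn_ge_nat//; lra.
  apply: (Hn0 (Num.truncn (t / 4))) => //; first lra.
    by rewrite -ler_pdivlMr.
  by move: tn; rewrite -[(Num.truncn _).+1%:R]natr1 ltr_pdivrMr// mulrDl mul1r.
apply/fine_cvgP; split.
  have [T HT] := H 1 ltr01.
  near=> t; rewrite ge0_fin_numE ?energy_ge0//.
  have Tt : T <= t by near: t; exact/nbhs_pinfty_ge/num_real.
  by rewrite (le_lt_trans (HT t Tt)) ?ltry.
apply/cvgrPdist_le => e e0; have [T HT] := H e e0.
near=> t; rewrite /= sub0r normrN ger0_norm ?fine_ge0 ?energy_ge0//.
have := HT t; have : T <= t by near: t; exact/nbhs_pinfty_ge/num_real.
move=> Tt /(_ Tt) Et.
rewrite -lee_fin fineK// ge0_fin_numE ?energy_ge0//.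
by rewrite (le_lt_trans Et) ?ltry.
Unshelve. all: by end_near. Qed.

End energy.

(** * Decay of the energy *)

Section decay.
Context {R : realType}.
Local Notation MR := (measurableTypeR R).
Local Notation mu := (@lebesgue_measure R).
Variables (Sigma : set (R * R)) (S : R -> set R).
Hypothesis gS : sv_graph S = rot45 @` Sigma.
Hypothesis S200 : sv_iter2 S 0 0.
Hypothesis S2le : forall x y, sv_iter2 S x y -> `|y| <= `|x|.
Variables (z0 z1 : R -> R) (z : R -> R -> R) (f g : R -> R).

Local Notation sigma := (sup_radius (sv_iter2 S)).

Lemma wave_solution_le_iter p : (1 <= p)%E ->
  wave_solution Sigma p z0 z1 z f g ->
  {ae mu, forall s : R, -1 < s -> forall n : nat,
    `|g (s + n%:R * 4)| <= iter n sigma `|g s|}.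
Proof.
move=> p1 sol; apply: ae_imply (wave_solution_steps gS p1 sol) => s Hs s1.
elim=> [|n IH]; first by rewrite mul0r addr0.
exact: le_sup_radius IH (Hs s1 n).
Qed.

Hypothesis rholt : forall r : R, 0 < r -> (rho (sv_iter2 S) r < r%:E)%E.

(** Almost all the orbits start below the essential bound M of g on a window,
    hence are below the n-th iterate of sup_radius at M after n periods. *)
Lemma energy_oo_decay : wave_solution Sigma +oo z0 z1 z f g ->
  energy +oo f g t @[t --> +oo] --> 0%E.
Proof.
move=> sol; have p1 : (1 <= +oo :> \bar R)%E by exact: leey.
apply: energy_cvg0 => e e0; have [[_ gp] _ _ _] := sol.
have [M M0 gM] : exists2 M, 0 <= M &
    {ae mu, forall s, s \in `]-1, 5[ -> `|g s| <= M}.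
  by apply: Lp_on_oo_ae_bounded; apply: gp; lra.
have [n0 Hn0] := iter_sup_radius_cvg0 S200 S2le rholt M0 e0.
exists n0 => n t n0n t1 nt tn.
have gle : {ae mu, forall s : R, -1 < s < 5 -> `|g (s + n%:R * 4)| <= e}.
  apply: ae_imply2 gM (wave_solution_le_iter p1 sol) => s gsM gs /andP[s1 s5].
  apply: (le_trans (gs s1 n)); apply: le_trans Hn0.
  apply: le_trans (iter_sup_radius_le S200 S2le _ n0n) => //.
  by apply: iter_sup_radius_homo => //; apply: gsM; rewrite in_itv/= s1.
have tr := ae_lebesgue_preserving
  (lebesgue_preserving_translation (t - n%:R * 4)) gle.
have rf := ae_lebesgue_preserving
  (lebesgue_preserving_reflection (t - n%:R * 4)) gle.
have fg := ae_lebesgue_preserving (lebesgue_preserving_translation t)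
  (wave_solution_reflection p1 sol).
rewrite /energy /Xp_norm unlock lebesgue_measureT_gt0.
rewrite muleC lee_pdivrMr ?sqrt2_gt0// -EFinM ge_max.
apply/andP; split; apply/ess_supP.
  apply: ae_imply2 tr fg => x gx fgx /=; rewrite patchE lee_fin.
  case: ifPn => [|_]; last by rewrite normr0 mulr_ge0 ?sqrtr_ge0// ltW.
  rewrite inE/= in_itv/= => /andP[x0 x1].
  rewrite norm_wave_xDt mulrC ler_wpM2r ?sqrtr_ge0//.
  rewrite fgx ?normrN; last lra.
  have -> : t + x = t - n%:R * 4 + x + n%:R * 4 by ring.
  by apply: gx; apply/andP; split; lra.
apply: ae_imply rf => x gx /=; rewrite patchE lee_fin.
case: ifPn => [|_]; last by rewrite normr0 mulr_ge0 ?sqrtr_ge0// ltW.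
rewrite inE/= in_itv/= => /andP[x0 x1].
rewrite norm_wave_xBt mulrC ler_wpM2r ?sqrtr_ge0//.
have -> : t - x = t - n%:R * 4 - x + n%:R * 4 by ring.
by apply: gx; apply/andP; split; lra.
Qed.

Variable r : R.
Hypothesis r1 : 1 <= r.
Hypothesis sol : wave_solution Sigma r%:E z0 z1 z f g.

Let r0 : 0 < r. Proof. exact: lt_le_trans r1. Qed.

Let p1 : (1 <= r%:E)%E. Proof. by rewrite lee_fin. Qed.

Let powRK (e : R) : 0 <= e -> (e `^ r^-1) `^ r = e.
Proof. by move=> e0; rewrite -powRrM mulVf ?gt_eqF// powRr1. Qed.

Let measurable_f T : 0 < T -> measurable_fun (`]0, T[ : set MR) (f : MR -> MR).
Proof.
by have [[fp _] _ _ _] := sol => T0; apply: Lp_on_measurable (fp _ T0).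
Qed.

Let measurable_g T : -1 < T ->
  measurable_fun (`]-1, T[ : set MR) (g : MR -> MR).
Proof.
by have [[_ gp] _ _ _] := sol => T0; apply: Lp_on_measurable (gp _ T0).
Qed.

Local Notation W := (`](-1 : R), (5 : R)[%classic : set MR).

Local Notation I := (`](0 : R), (1 : R)[%classic : set MR).

(* At a time t >= 1 of the n-th period, x -> t + x and x -> t - x map (0, 1)
   into the translate by 4 n of the interval (-1, 5). *)
Let window n := (\int[mu]_(s in W) (`|g (s + n%:R * 4)| `^ r)%:E)%E.

Let measurable_window n :
  measurable_fun W (fun s => (`|g (s + n%:R * 4)| `^ r)%:E).
Proof.
have n0 : 0 <= n%:R :> R by [].
apply: (@measurable_norm_powR_comp _ _ `]-1, 5 + n%:R * 4[%classic
   (fun s : MR => s + n%:R * 4)) => //.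
- by move=> x /=; rewrite !in_itv/= => /andP[x1 x5]; apply/andP; split; lra.
- by apply: measurable_g; lra.
- exact: measurable_funD.
Qed.

(** Dominated convergence: every orbit tends to 0, below its first term. *)
Lemma window_cvg0 (e : R) : 0 < e ->
  exists n0 : nat, forall n, (n0 <= n)%N -> (window n <= e%:E)%E.
Proof.
move=> e0.
have gp : Lp_on W r%:E g.
  by have [[_ gp] _ _ _] := sol; apply: gp; lra.
have ig := Lp_on_integrable_powR (measurable_itv _) r1 gp.
have gle := wave_solution_le_iter p1 sol.
have [||_ _] := @dominated_convergence _ _ _ mu W (measurable_itv _)
  (fun n s => (`|g (s + n%:R * 4)| `^ r)%:E) (cst 0%E)
  (fun s => (`|g s| `^ r)%:E) measurable_window (measurable_cst _) _ ig _.
- apply: ae_imply gle => s gs; rewrite /= in_itv/= => /andP[s1 s5].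
  apply: cvg_EFin; first exact: nearW.
  apply/cvgrPdist_le => d d0.
  have dr0 : 0 < d `^ r^-1 by exact: powR_gt0.
  have [n0 Hn0] := iter_sup_radius_cvg0 S200 S2le rholt (normr_ge0 (g s)) dr0.
  exists n0 => // n /= n0n; rewrite sub0r normrN ger0_norm ?powR_ge0//.
  rewrite -[leRHS](powRK (ltW d0)) ge0_ler_powR ?nnegrE ?(ltW r0) ?powR_ge0//.
  apply: (le_trans (gs s1 n)); apply: le_trans Hn0.
  exact: iter_sup_radius_le.
- apply: ae_imply gle => s gs n; rewrite /= in_itv/= => /andP[s1 s5].
  rewrite lee_fin ger0_norm ?powR_ge0//.
  rewrite ge0_ler_powR ?nnegrE ?(ltW r0) ?powR_ge0//.
  apply: (le_trans (gs s1 n)).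
  exact: (@iter_sup_radius_le _ _ S200 S2le 0).
rewrite integral0 => /fine_cvgP[[N1 _ wfin] /cvgrPdist_le/(_ e e0)[N2 _ we]].
exists (maxn N1 N2) => n; rewrite geq_max => /andP[/wfin/= wn /we/=].
rewrite sub0r normrN => /(le_trans (ler_norm _)).
by rewrite -lee_fin fineK.
Qed.

Lemma integral_le_window n (phi : MR -> MR) (h : MR -> MR) :
  lebesgue_preserving phi ->
  (forall x, 0 < x < 1 -> -1 < phi x < 5 /\ h x = phi x + n%:R * 4) ->
  (\int[mu]_(x in I) (`|g (h x)| `^ r)%:E
    <= window n)%E.
Proof.
move=> phiP phi_h; have [mphi _] := phiP.
rewrite /window [leRHS](ge0_integral_lebesgue_preserving phiP)//.
have sub : I `<=` phi @^-1` W.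
  by move=> x /=; rewrite in_itv/= => /phi_h[? _]; rewrite in_itv.
have mpW : measurable (phi @^-1` W).
  by rewrite -[_ @^-1` _]setTI; exact: mphi.
rewrite (@eq_integral _ _ _ _ _
  (fun x => (`|g (phi x + n%:R * 4)| `^ r)%:E)); last first.
  by move=> x; rewrite inE/= in_itv/= => /phi_h[_ ->].
apply: ge0_subset_integral => //.
have mphiW : measurable_fun (phi @^-1` W) phi by exact: measurable_funS mphi.
apply: (measurable_comp _ _ (@measurable_window n) mphiW) => //.
by move=> _ [x ? <-].
Qed.

Lemma energy_le_window n t : 1 <= t -> n%:R * 4 <= t -> t < n%:R * 4 + 4 ->
  (energy r%:E f g t <= (window n + window n) `^ r^-1)%E.
Proof.
move=> t1 nt tn.
have mf : measurable_fun I (fun x : MR => (`|f (t + x)| `^ r)%:E).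
  apply: (@measurable_norm_powR_comp _ _ `]0, t + 1[%classic
    (fun x : MR => t + x)) => //.
  - by move=> x /=; rewrite !in_itv/= => /andP[x0 x1]; apply/andP; split; lra.
  - by apply: measurable_f; lra.
  - exact: measurable_funD.
have mg : measurable_fun I (fun x : MR => (`|g (t - x)| `^ r)%:E).
  apply: (@measurable_norm_powR_comp _ _ `]-1, t[%classic
    (fun x : MR => t - x)) => //.
  - by move=> x /=; rewrite !in_itv/= => /andP[x0 x1]; apply/andP; split; lra.
  - by apply: measurable_g; lra.
  - exact: measurable_funB.
have mg' : measurable_fun I (fun x : MR => (`|g (t + x)| `^ r)%:E).
  apply: (@measurable_norm_powR_comp _ _ `]-1, t + 1[%classic
    (fun x : MR => t + x)) => //.
  - by move=> x /=; rewrite !in_itv/= => /andP[x0 x1]; apply/andP; split; lra.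
  - by apply: measurable_g; lra.
  - exact: measurable_funD.
have Ifg : (\int[mu]_(x in I) (`|f (t + x)| `^ r)%:E =
            \int[mu]_(x in I) (`|g (t + x)| `^ r)%:E)%E.
  apply: ge0_ae_eq_integral => //.
  have fg := ae_lebesgue_preserving (lebesgue_preserving_translation t)
    (wave_solution_reflection p1 sol).
  apply: ae_imply fg => x fgx; rewrite /= in_itv/= => /andP[x0 x1].
  by rewrite fgx ?normrN//; lra.
have If : (\int[mu]_(x in I) (`|f (t + x)| `^ r)%:E <= window n)%E.
  rewrite Ifg; apply: (integral_le_window
    (lebesgue_preserving_translation (t - n%:R * 4))) => x /andP[x0 x1].
  by split; [apply/andP; split; lra|ring].
have Ig : (\int[mu]_(x in I) (`|g (t - x)| `^ r)%:E <= window n)%E.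
  apply: (integral_le_window
    (lebesgue_preserving_reflection (t - n%:R * 4))) => x /andP[x0 x1].
  by split; [apply/andP; split; lra|ring].
rewrite (energy_finE r1 mf mg).
have rV0 : 0 <= r^-1 by rewrite invr_ge0 ltW.
apply: (le_poweRD rV0 _ _ If Ig).
- by apply: integral_ge0 => x _; rewrite lee_fin powR_ge0.
- by apply: integral_ge0 => x _; rewrite lee_fin powR_ge0.
Qed.

Lemma energy_fin_decay : energy r%:E f g t @[t --> +oo] --> 0%E.
Proof.
apply: energy_cvg0 => e e0.
have er0 : 0 < e `^ r / 2 by rewrite divr_gt0// powR_gt0.
have [n0 Hn0] := window_cvg0 er0.
exists n0 => n t n0n t1 nt tn.
apply: (le_trans (energy_le_window t1 nt tn)).
have w0 : (0 <= window n)%E.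
  by apply: integral_ge0 => x _; rewrite lee_fin powR_ge0.
have rV0 : 0 <= r^-1 by rewrite invr_ge0 ltW.
have wn := Hn0 n n0n.
have -> : e%:E = ((e `^ r)%:E `^ r^-1)%E.
  by rewrite poweR_EFin -powRrM mulfV ?gt_eqF// powRr1// ltW.
rewrite [e `^ r]splitr EFinD.
exact: (le_poweRD rV0 w0 w0 wn wn).
Qed.

End decay.

(** * A solution of constant modulus *)

Section cycle.
Context {R : realType}.
Implicit Types (S : R -> set R).

(** All three moduli along x -> w -> y are equal, so w and y are x or -x. If
    y = x, then x -> w -> x is a cycle; if y = -x, then w is x or y, which makes
    it a fixed point. *)
Lemma iter2_isometric_cycle S (x y : R) :
  (forall u v, S u v -> `|v| <= `|u|) -> sv_iter2 S x y -> `|y| = `|x| ->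
  exists a b, [/\ S a b, S b a, `|a| = `|x| & `|b| = `|x|].
Proof.
move=> Sle [w [Sxw Swy]] yx.
have wx : `|w| = `|x|.
  by apply/eqP; rewrite eq_le Sle//= -yx Sle.
have [yE|yE] : y = x \/ y = - x.
- by move/eqP: yx; rewrite eqr_norm2 => /orP[]/eqP; [left|right].
- by rewrite yE in Swy; exists x, w.
have [wE|wE] : w = x \/ w = - x.
- by move/eqP: wx; rewrite eqr_norm2 => /orP[]/eqP; [left|right].
- by rewrite wE in Sxw; exists x, x.
by have yw : y = w by [rewrite yE wE]; rewrite yw in Swy; exists w, w.
Qed.

End cycle.

Section bounded_Lp_on.
Context {R : realType}.
Local Notation MR := (measurableTypeR R).
Local Notation mu := (@lebesgue_measure R).

Lemma bounded_Lp_on (D : set MR) (p : \bar R) (h : R -> R) (M : R) :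
  measurable D -> (mu D < +oo)%E -> (1 <= p)%E ->
  measurable_fun D (h : MR -> MR) -> (forall x, D x -> `|h x| <= M) ->
  Lp_on D p h.
Proof.
move=> mD Doo p1 mh hM.
have mhD : measurable_fun [set: MR] (h \_ D : MR -> MR).
  exact/(measurable_restrictT _ mD).
have hM' x : `|(h \_ D) x| <= Num.max 0 M.
  rewrite patchE; case: ifPn => [|_]; last by rewrite normr0 le_max lexx.
  by rewrite inE => /hM; rewrite le_max orbC => ->.
rewrite /Lp_on; apply/andP; split; rewrite inE//= /finite_norm unlock.
case: p p1 => [r||//]; rewrite ?lee_fin => r1.
- have r0 : 0 < r by exact: lt_le_trans r1.
  apply: poweR_lty.
  have -> : (fun x => `|(EFin \o h \_ D) x| `^ r)%E =
      (fun x => (`|h x| `^ r)%:E) \_ D.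
    apply/funext => x /=; rewrite !patchE; case: ifPn => // _.
    by rewrite normr0 powR0// gt_eqF.
  rewrite -integral_mkcond.
  apply: (@le_lt_trans _ _ (\int[mu]_(x in D) (cst (M `^ r)%:E) x)%E).
    apply: ge0_le_integral => //.
    - apply/measurable_EFinP; apply: (measurableT_comp (measurable_powR _)).
      exact: measurableT_comp.
    - move=> x Dx; rewrite lee_fin ge0_ler_powR ?nnegrE ?(ltW r0)//.
        by rewrite (le_trans _ (hM _ Dx)).
      exact: hM.
  by rewrite integral_cst// lte_mul_pinfty// lee_fin powR_ge0.
- case: ifPn => // _.
  apply: (@le_lt_trans _ _ (Num.max 0 M)%:E); last exact: ltry.
  by apply/ess_supP; apply: aeW => x; rewrite /= lee_fin.
Qed.

End bounded_Lp_on.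

Section weak_deriv_linear.
Context {R : realType}.
Local Notation mu := (@lebesgue_measure R).

(** Integration by parts; a test function vanishes at 0 and 1. *)
Lemma weak_deriv01_linear (c : R) : weak_deriv01 (fun x => c * x) (fun=> c).
Proof.
move=> phi [dphi supp].
have dphi0 x : derivable phi x 1 by exact: (dphi 0%N).
have dphi1 x : derivable (derive1 phi) x 1 by exact: (dphi 1%N).
have cphi : continuous phi.
  by move=> x; apply: differentiable_continuous; rewrite -derivable1_diffP.
have cphi1 : continuous (derive1 phi).
  by move=> x; apply: differentiable_continuous; rewrite -derivable1_diffP.
have phi0 x : ~ (0 < x < 1) -> phi x = 0.
  move=> x01; apply: contrapT => /eqP phix; apply: x01.
  have /supp : closure [set x | phi x != 0] x by exact: subset_closure.
  by rewrite /= in_itv.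
have clin : continuous (fun x : R => c * x).
  by move=> x; apply: cvgM; [exact: cvg_cst|exact: cvg_id].
have ic (h : R -> R) : continuous h -> mu.-integrable `[0, 1] (EFin \o h).
  move=> ch; apply: continuous_compact_integrable; first exact: segment_compact.
  exact: continuous_subspaceT.
have closed (h : R -> R) : continuous h ->
    \int[mu]_(x in `]0, 1[) h x = \int[mu]_(x in `[0, 1]) h x.
  move=> ch; rewrite Rintegral_itv_bndo_bndc; last first.
    apply: integrableS (ic _ ch) => // x /=.
    by rewrite !in_itv/= => /andP[] /ltW-> // /ltW->.
  rewrite Rintegral_itv_obnd_cbnd//.
  apply: integrableS (ic _ ch) => // x /=.
  by rewrite !in_itv/= => /andP[/ltW->].
have LR (h : R -> R) : (forall x, derivable h x 1) -> continuous h ->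
    derivable_oo_LRcontinuous h 0 1.
  move=> dh ch; split => //.
    by apply: cvg_at_right_filter; exact: ch.
  by apply: cvg_at_left_filter; exact: ch.
rewrite !closed; last 2 first.
- by move=> x; apply: cvgM; [exact: cvg_cst|exact: cphi].
- by move=> x; apply: cvgM; [exact: clin|exact: cphi1].
have cc : {within `[0, 1], continuous (fun _ : R => c)}.
  by apply: continuous_subspaceT => x; exact: cvg_cst.
have dlin x : derivable (fun x : R => c * x) x 1.
  by apply: derivableM; [exact: derivable_cst|exact: derivable_id].
have dlinE : {in `]0, 1[, derive1 (fun x : R => c * x) =1 (fun=> c)}.
  by move=> x _; rewrite (@derive1Ml _ id)// derive1_id mulr1.
have cphi1' : {within `[0, 1], continuous (derive1 phi)}.
  exact: continuous_subspaceT.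
rewrite (Rintegration_by_parts ltr01 cc (LR _ dlin clin) dlinE cphi1'
  (LR _ dphi0 cphi))//.
by rewrite !phi0 ?mulr0 ?subr0 ?sub0r// ltxx// andbF.
Qed.

End weak_deriv_linear.

Section square_wave.
Context {R : realType}.
Local Notation MR := (measurableTypeR R).
Local Notation mu := (@lebesgue_measure R).

Lemma lebesgue_measure_itv_lty (c d : bool) (u v : R) :
  (mu [set` Interval (BSide c u) (BSide d v)] < +oo)%E.
Proof. by rewrite lebesgue_measure_itv/=; case: ifP; rewrite -?EFinB ltry. Qed.

(** Translation by 2 exchanges this set with its complement in the half-line
    from -1 on, so that the square wave alternates between its two values. *)
Definition up_phase : set MR :=
  \bigcup_k `[k%:R * 4 - 1, k%:R * 4 + 1[%classic.

Definition square_wave (a b s : R) : R := b + (a - b) * \1_up_phase s.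

Lemma square_wave_up a b s : up_phase s -> square_wave a b s = a.
Proof. by move=> ?; rewrite /square_wave indicE mem_set// mulr1 subrKC. Qed.

Lemma square_wave_down a b s : ~ up_phase s -> square_wave a b s = b.
Proof. by move=> ?; rewrite /square_wave indicE memNset// mulr0 addr0. Qed.

Lemma up_phase_shift s : -1 <= s -> up_phase (s + 2) <-> ~ up_phase s.
Proof.
move=> s1; split=> [[j _ /=]|nup].
  rewrite in_itv/= => /andP[js sj] [k _ /=]; rewrite in_itv/= => /andP[ks sk].
  have : (j%:R < k.+1%:R :> R) by rewrite -[k.+1%:R]natr1; lra.
  rewrite ltr_nat ltnS -(ler_nat R); lra.
have s0 : 0 <= (s + 1) / 4 by rewrite divr_ge0//; lra.
have /andP[ks sk] := truncn_itv s0.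
move: ks sk; rewrite -[(Num.truncn _).+1%:R]natr1.
rewrite ler_pdivlMr// ltr_pdivrMr// mulrDl.
set k := Num.truncn _ => ks sk.
exists k.+1 => //=; rewrite in_itv/= -[k.+1%:R]natr1 mulrDl.
apply/andP; split; last lra.
rewrite leNgt; apply/negP => H; apply: nup; exists k => //=.
by rewrite in_itv/=; apply/andP; split; lra.
Qed.

Lemma square_wave_step (S : R -> set R) a b s : S a b -> S b a -> -1 <= s ->
  S (square_wave a b s) (square_wave a b (s + 2)).
Proof.
move=> Sab Sba s1; have upE := up_phase_shift s1.
have [up|dn] := pselect (up_phase s).
  by rewrite square_wave_up// square_wave_down// => /upE.
by rewrite square_wave_down// square_wave_up//; exact/upE.
Qed.

Lemma norm_square_wave a b r s : `|a| = r -> `|b| = r ->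
  `|square_wave a b s| = r.
Proof.
have [up|dn] := pselect (up_phase s).
  by rewrite square_wave_up.
by rewrite square_wave_down.
Qed.

Lemma measurable_square_wave a b :
  measurable_fun [set: MR] (square_wave a b : MR -> MR).
Proof.
apply: measurable_funD => //; apply: measurable_funM => //.
apply: measurable_indic; apply: bigcupT_measurable => k.
exact: measurable_itv.
Qed.

Lemma square_wave_small a b s : -1 <= s -> s < 1 -> square_wave a b s = a.
Proof.
move=> s1 s1'; apply: square_wave_up; exists 0%N => //=.
by rewrite in_itv/= mul0r sub0r add0r s1.
Qed.

Variables (a b r : R).
Hypotheses (ar : `|a| = r) (br : `|b| = r).

Let g : R -> R := square_wave a b.
Let f : R -> R := fun s => - g s.
Let z t x := (Num.sqrt 2)^-1 * integral_from0 f (t + x) +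
             (Num.sqrt 2)^-1 * integral_from0 g (t - x).
Let z0 : R -> R := fun x => (- (Num.sqrt 2 * a)) * x.
Let z1 : R -> R := fun=> 0.

Let integrable_g (u v : R) : mu.-integrable `[u, v] (EFin \o g).
Proof.
apply: measurable_bounded_integrable => //.
- exact: lebesgue_measure_itv_lty.
- exact: measurable_funS (measurable_square_wave a b).
- exists r; split; first exact: num_real.
  by move=> M rM s _; rewrite /= (norm_square_wave _ ar br) ltW.
Qed.

Let integral_from0_f t : integral_from0 f t = - integral_from0 g t.
Proof.
rewrite /integral_from0 /f opprB.
have N (u v : R) :
    \int[mu]_(s in `[u, v]) (- g s) = - \int[mu]_(s in `[u, v]) g s.
  under eq_Rintegral do rewrite -mulN1r.
  by rewrite RintegralZl// mulN1r.
by rewrite !N opprK addrC.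
Qed.

Let integral_from0_g x : -1 <= x -> x < 1 -> integral_from0 g x = a * x.
Proof.
move=> x1 x1'.
have cst_int (u v : R) : -1 <= u -> v < 1 -> u <= v ->
    \int[mu]_(s in `[u, v]) g s = a * (v - u).
  move=> u1 v1 uv; rewrite (@eq_Rintegral _ _ _ _ _ (cst a)); last first.
    move=> s; rewrite inE/= in_itv/= => /andP[us sv].
    by apply: square_wave_small; lra.
  rewrite Rintegral_cst//= lebesgue_measure_itv/= lte_fin.
  case: ltP => [_|vu]; first by rewrite -EFinB.
  have uvE : u = v by apply/eqP; rewrite eq_le uv vu.
  by rewrite uvE subrr.
rewrite /integral_from0; have [x0|x0] := leP 0 x.
  rewrite cst_int ?lerN10//.
  have [->|xn0] := eqVneq x 0; first by rewrite set_itv1 Rintegral_set1 !subr0.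
  rewrite [`[x, 0]%classic]set_itv_ge; last first.
    by rewrite bnd_simp -ltNge lt_neqAle eq_sym xn0.
  by rewrite Rintegral_set0 !subr0.
rewrite [`[0, x]%classic]set_itv_ge ?bnd_simp -?ltNge//.
rewrite Rintegral_set0 cst_int//; [ring|exact: ltW].
Qed.

(** On (-1, 1) the wave is constant, g = a, so that the initial position is
    linear and the initial velocity is 0. *)
Lemma square_wave_solution (Sigma : set (R * R)) S p :
  sv_graph S = rot45 @` Sigma -> (1 <= p)%E -> S a b -> S b a ->
  in_Xp p z0 z1 /\ wave_solution Sigma p z0 z1 z f g.
Proof.
move=> gS p1 Sab Sba.
have I01 : (mu `]0%R, 1%R[ < +oo)%E.
  exact: lebesgue_measure_itv_lty.
have cstLp (c : R) : Lp_on `]0, 1[ p (fun=> c).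
  by apply: (@bounded_Lp_on _ _ _ _ `|c|).
have lin : continuous z0.
  by move=> x; apply: cvgM; [exact: cvg_cst|exact: cvg_id].
split; [split; [split|exact: cstLp]|split].
- apply: (@bounded_Lp_on _ _ _ _ `|Num.sqrt 2 * a|) => //.
    exact: measurable_funM.
  move=> x; rewrite /= in_itv/= => /andP[x0 x1].
  by rewrite normrM normrN ler_piMr// ger0_norm ltW.
- exists (fun=> - (Num.sqrt 2 * a)); split; first exact: cstLp.
  exact: weak_deriv01_linear.
- exists z0; split; first exact: continuous_subspaceT.
    exact: aeW.
  by rewrite /z0 mulr0.
- have gLp u v : Lp_on `]u, v[ p g.
    apply: (@bounded_Lp_on _ _ _ _ r) => //.
    + exact: lebesgue_measure_itv_lty.
    + exact: measurable_funS (measurable_square_wave a b).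
    + by move=> x _; rewrite (norm_square_wave _ ar br).
  have fLp u v : Lp_on `]u, v[ p f.
    apply: (@bounded_Lp_on _ _ _ _ r) => //.
    + exact: lebesgue_measure_itv_lty.
    + apply: measurableT_comp => //.
      exact: measurable_funS (measurable_square_wave a b).
    + by move=> x _; rewrite normrN (norm_square_wave _ ar br).
  by split => T _.
- by [].
- apply: aeW => t t0; split.
    by rewrite /z addr0 subr0 integral_from0_f mulrN addNr.
  rewrite /wave_t /wave_x /f -mulNr.
  have : sv_graph S (g (t - 1), g (t + 1)).
    rewrite (_ : t + 1 = t - 1 + 2); last by ring.
    by apply: square_wave_step => //; lra.
  rewrite gS rot45_imageP; congr (Sigma (_, _)); congr (_ / _); ring.
(* At x = 1 the square wave has already switched to b. *)
- exists [set 1]; split; [exact: measurable_set1|exact: lebesgue_measure_set1|].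
  move=> x /= nx; apply: contrapT => x1; apply: nx => /andP[x0 x1'].
  have {}x1 : x < 1 by rewrite lt_neqAle x1' andbT; exact/eqP.
  rewrite /z /z0 /z1 /wave_t /f add0r sub0r integral_from0_f.
  rewrite !integral_from0_g; try lra.
  rewrite /g !square_wave_small; try lra.
  split; last by rewrite addNr mul0r.
  rewrite (_ : _ + _ = - ((Num.sqrt 2)^-1 * 2) * (a * x)); last by ring.
  have -> : (Num.sqrt 2)^-1 * 2 = Num.sqrt 2 :> R.
    by rewrite -[X in _ * X]sqr_sqrt2 mulKf ?sqrt2_neq0.
  by rewrite !mulNr mulrA.
Qed.

End square_wave.

Section constant_modulus.
Context {R : realType}.
Local Notation MR := (measurableTypeR R).
Local Notation mu := (@lebesgue_measure R).

Lemma integral01_cst (c : \bar R) :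
  (\int[mu]_(x in [set` `](0 : R)%R, (1 : R)%R[]) c = c)%E.
Proof.
have /= -> := integral_cst mu (measurable_itv `](0 : R), (1 : R)[) c.
by rewrite lebesgue_measure_itv/= lte_fin ltr01 sube0 mule1.
Qed.

(** The energy at time t only depends on the moduli of f and g. *)
Lemma energy_constant_modulus (p : \bar R) (f g : R -> R) (r : R) :
  (1 <= p)%E -> 0 < r -> (forall s, `|f s| = r) -> (forall s, `|g s| = r) ->
  exists2 k, 0 < k & forall t, (k%:E <= energy p f g t)%E.
Proof.
move=> p1 r0 fr gr.
have s0 := @sqrt2_gt0 R.
case: p p1 => [q||//]; rewrite ?lee_fin => p1.
- exists ((2 `^ (- (q / 2)) *
    ((Num.sqrt 2 * r) `^ q + (Num.sqrt 2 * r) `^ q)) `^ q^-1).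
    by rewrite powR_gt0// mulr_gt0 ?powR_gt0// addr_gt0// powR_gt0// mulr_gt0.
  move=> t; rewrite /energy /Xp_norm.
  under eq_integral do rewrite norm_wave_xDt norm_wave_xBt fr gr.
  by rewrite integral01_cst poweR_EFin.
exists r => // t; rewrite /energy /Xp_norm muleC lee_pdivlMr// -EFinM le_max.
apply/orP; left; rewrite unlock lebesgue_measureT_gt0.
set F := abse \o _.
have [x x01 Fx] := ae_itv_exists (ess_sup_ge mu F) (@ltr01 R).
apply: (le_trans _ Fx).
rewrite /F /= patchE mem_set; last by rewrite /= in_itv.
by rewrite norm_wave_xDt fr mulrC.
Qed.

End constant_modulus.

Theorem theorem40 (R : realType) (Sigma : set (R * R)) (S : R -> set R)
    (p : \bar R) :
  damping_set Sigma -> sv_graph S = rot45 @` Sigma -> (1 <= p)%E ->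
  (strongly_stable Sigma p -> strict_damping (sv_iter2 S)) /\
  (strict_damping (sv_iter2 S) ->
   (forall r : R, 0 < r -> (rho (sv_iter2 S) r < r%:E)%E) ->
   strongly_stable Sigma p).
Proof.
move=> damp gS p1; split.
- move=> stable.
  have [S0 Sle [phi [mphi lphi Sphi]]] := (damping_setP gS).1 damp.
  apply/strict_dampingP; split; first by exists 0.
  + move=> x y Sxy xy0.
    have yx : `|y| <= `|x| by case: Sxy => w [/Sle wx /Sle /le_trans]; exact.
    rewrite lt_neqAle yx andbT; apply/eqP => yxE.
    have x0 : 0 < `|x|.
      rewrite normr_gt0; apply/eqP => x0; apply: xy0.
      by move: yx; rewrite x0 normr0 normr_le0 => /eqP ->.
    have [a [b [Sab Sba ax bx]]] := iter2_isometric_cycle Sle Sxy yxE.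
    have [inX sol] := square_wave_solution ax bx gS p1 Sab Sba.
    have nf s : `|- square_wave a b s| = `|x|.
      by rewrite normrN (norm_square_wave _ ax bx).
    have [k k0 Ek] := energy_constant_modulus p1 x0 nf
      (fun s => norm_square_wave s ax bx).
    have : (k%:E <= 0)%E.
      by apply: cvge_to_ge (stable _ _ _ _ _ inX sol) _; exact: nearW.
    by rewrite lee_fin leNgt k0.
  + exists (phi \o phi); split.
    * exact: univ_measurable_fun_comp.
    * exact: linear_growth_comp.
    * by move=> x; exists (phi x).
- move=> /strict_dampingP[S20 S2lt _] rholt z0 z1 z f g _ sol.
  have S2le x y : sv_iter2 S x y -> `|y| <= `|x|.
    by have [[-> ->]//|xy0] := pselect ((x, y) = (0, 0)) => /S2lt /(_ xy0)/ltW.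
  move: p1 sol; case: p => [r||//] p1 sol.
  + exact: (energy_fin_decay gS S20 S2le rholt p1 sol).
  + exact: (energy_oo_decay gS S20 S2le rholt sol).
Qed.
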